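(* For every constant $0<p<1$ there exist constants $c_1=c_1(p)>0$ and $c_2=c_2(p)>0$ such that for $G\in\mathcal{G}(n,p)$, with probability tending to $1$ as $n\to\infty$, \[ c_1\frac{n}{\log n}<\theta_0(G)<c_2\frac{n}{\log n}. \]
   Context: $\mathcal{G}(n,p)$ is the random graph on $[n]$ with each pair an edge independently with probability $p$. A clique cover of $G$ is a family $\mathcal{C}=\{C_1,\dots,C_m\}$ of vertex sets of cliques of $G$ such that every edge of $G$ lies in some $C_i$. Its thickness is $\theta_0(\mathcal{C})=\max_{v\in V(G)}|\{i: v\in C_i\}|$, and $\theta_0(G)$ is the minimum thickness over all clique covers of $G$. *)

(* Defs.v *)
From HB Require Import structures.
From mathcomp Require Import all_boot all_order all_algebra.
From mathcomp Require Import reals.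

Set Implicit Arguments.
Unset Strict Implicit.
Unset Printing Implicit Defensive.

Import Order.TTheory GRing.Theory Num.Theory.

Definition vpairs (T : finType) : {set {set T}} := [set e : {set T} | #|e| == 2].

(* A simple graph on T is given by its set of edges, an edge being a
   two-element set of vertices. *)
Definition sgraph (T : finType) := {E : {set {set T}} | E \subset vpairs T}.

Definition edges (T : finType) (G : sgraph T) : {set {set T}} := val G.

(* The empty set and the singletons count as cliques. *)
Definition clique (T : finType) (G : sgraph T) (K : {set T}) : bool :=
  [forall x in K, forall y in K, (x != y) ==> ([set x; y] \in edges G)].

Definition clique_cover (T : finType) (G : sgraph T) (C : {set {set T}}) : bool :=
  [forall K in C, clique G K] && [forall e in edges G, exists K in C, e \subset K].

Definition thickness (T : finType) (C : {set {set T}}) : nat :=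
  \max_(v : T) #|[set K in C | v \in K]|.

(* The set of all edges is itself a clique cover (edges_clique_cover), so the
   argmin ranges over a nonempty set of covers and theta0 is a true minimum
   (theta0_attained, theta0_min). *)
Definition theta0 (T : finType) (G : sgraph T) : nat :=
  thickness [arg min_(C < edges G | clique_cover G C) thickness C].

Lemma edges_clique_cover (T : finType) (G : sgraph T) :
  clique_cover G (edges G).
Proof.
apply/andP; split.
  apply/forall_inP => e eG.
  have : e \in vpairs T by exact: (subsetP (valP G)) eG.
  rewrite /vpairs inE => /cards2P[a [b [ab eE]]].
  apply/forall_inP => x xe; apply/forall_inP => y ye; apply/implyP => xy.
  suff <- : e = [set x; y] by [].
  apply/esym/eqP; rewrite eqEcard cards2 xy eE cards2 ab andbT -eE.
  by apply/subsetP => z; rewrite !inE => /orP[] /eqP ->.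
by apply/forall_inP => e eG; apply/exists_inP; exists e.
Qed.

Lemma theta0_attained (T : finType) (G : sgraph T) :
  exists2 C, clique_cover G C & thickness C = theta0 G.
Proof.
rewrite /theta0; case: arg_minnP => [|C CG _]; first exact: edges_clique_cover.
by exists C.
Qed.

Lemma theta0_min (T : finType) (G : sgraph T) (C : {set {set T}}) :
  clique_cover G C -> theta0 G <= thickness C.
Proof.
rewrite /theta0; case: arg_minnP => [|D _ minD]; first exact: edges_clique_cover.
exact: minD.
Qed.

(* Repeated members never lower the thickness, so taking covers to be sets
   rather than indexed families does not change the minimum. *)
Lemma theta0_min_seq (T : finType) (G : sgraph T) (s : seq {set T}) :
  clique_cover G [set:: s] ->
  theta0 G <= \max_(v : T) count (fun K : {set T} => v \in K) s.
Proof.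
move=> /theta0_min /leq_trans; apply.
apply/bigmax_leqP => v _; apply: leq_trans (leq_bigmax v).
rewrite -size_filter; apply: leq_trans (card_size _).
by apply: subset_leq_card; apply/fintype.subsetP => K; rewrite !inE mem_filter andbC.
Qed.

Local Open Scope ring_scope.

Definition gnp_mass (R : realType) (n : nat) (p : R) (G : sgraph 'I_n) : R :=
  \prod_(e in vpairs 'I_n) (if e \in edges G then p else 1 - p).

Definition gnp_prob (R : realType) (n : nat) (p : R) (A : pred (sgraph 'I_n)) : R :=
  \sum_(G : sgraph 'I_n | A G) gnp_mass p G.

Lemma gnp_prob_total (R : realType) (n : nat) (p : R) :
  gnp_prob p (fun _ : sgraph 'I_n => true) = 1.
Proof.
rewrite /gnp_prob /gnp_mass /edges.
pose V := vpairs 'I_n.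
pose m (E : {set {set 'I_n}}) : R := \prod_(e in V) (if e \in E then p else 1 - p).
have -> : \sum_(G : sgraph 'I_n) m (val G) = \sum_(E : {set {set 'I_n}} | E \subset V) m E.
  by apply: esym; exact: (@big_sub _ _ _ _ (fun E : {set {set 'I_n}} => E \subset V)  m).
pose F e : R := if e \in V then p else 0.
pose H e : R := if e \in V then 1 - p else 1.
have tot : \prod_e (F e + H e) = 1.
  by apply: big1 => e _; rewrite /F /H; case: ifP => _; rewrite ?add0r // subrKC.
rewrite -tot bigA_distr [RHS](bigID (fun E : {set {set 'I_n}} => E \subset V)) /=.
rewrite [X in _ + X]big1 ?addr0 => [|E /subsetPn[e eE eV]]; last first.
  by rewrite (bigD1 e) //= eE /F (negbTE eV) mul0r.
apply: eq_bigr => E EV; rewrite /m [RHS](bigID (mem V)) /=.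
rewrite [X in _ * X]big1 ?mulr1 => [|e eV].
  by apply: eq_bigr => e eV; rewrite /F /H eV.
rewrite /H (negbTE eV); case: ifP => // eE.
by rewrite (subsetP EV _ eE) in eV.
Qed.

(* Main.v *)
Require Import Defs.
From HB Require Import structures.
From mathcomp Require Import all_boot all_order all_algebra.
From mathcomp Require Import reals.
From mathcomp Require Import zify ring lra.

Set Implicit Arguments.
Unset Strict Implicit.
Unset Printing Implicit Defensive.

(** With high probability every vertex set W with at least t = O(sqrt n)
vertices spans more than a fixed proportion 1/r of its pairs (Chernoff, and a
union bound over the 2^n sets), and no clique has more than O(log n) vertices
(first moment). The graph then behaves deterministically. A set spanning a
proportion 1/r of its pairs has a vertex adjacent to 1/r of it; passing
repeatedly to such neighbourhoods finds a clique with k = Theta(log n) vertices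
in every set of size r^k t, and removing such cliques greedily partitions any
set W into at most |W|/k + r^k t cliques of size at most k. Partition the
vertices in this way; for each block b, group the outside vertices according to
their neighbourhood S in b, partition each group into cliques and join each of
these to S. The resulting cover has thickness O(n/k), because a block has only
2^k traces, a small power of n when k is a small multiple of log n. Conversely a vertex of
linear degree lies in Omega(n/log n) cliques of any cover, since each of them
covers only O(log n) of its edges. *)

(** * Neighbourhoods and cliques *)

Definition nbh (T : finType) (G : sgraph T) (v : T) : {set T} :=
  [set u | [set v; u] \in edges G].

Definition edges_in (T : finType) (G : sgraph T) (W : {set T}) : {set {set T}} :=
  [set e in edges G | e \subset W].

Lemma nbhC (T : finType) (G : sgraph T) (u v : T) : (u \in nbh G v) = (v \in nbh G u).
Proof. by rewrite !inE setUC. Qed.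

Lemma nbhxx (T : finType) (G : sgraph T) (v : T) : (v \in nbh G v) = false.
Proof.
rewrite inE; apply/negP => /(subsetP (valP G)).
by rewrite inE setUid cards1.
Qed.

Lemma cliqueP (T : finType) (G : sgraph T) (K : {set T}) :
  reflect {in K &, forall x y, x != y -> y \in nbh G x} (clique G K).
Proof.
apply: (iffP forall_inP) => [h x y xK yK xy|h x xK].
  by rewrite inE; have /forall_inP/(_ _ yK)/implyP -> := h x xK.
by apply/forall_inP => y yK; apply/implyP => xy; have := h x y xK yK xy; rewrite inE.
Qed.

Lemma clique_sub (T : finType) (G : sgraph T) (K S : {set T}) :
  S \subset K -> clique G K -> clique G S.
Proof.
move=> /subsetP SK /cliqueP h; apply/cliqueP => x y /SK xK /SK yK; exact: h.
Qed.

Lemma clique_setU (T : finType) (G : sgraph T) (K L : {set T}) :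
  clique G K -> clique G L -> {in K & L, forall x y, y \in nbh G x} ->
  clique G (K :|: L).
Proof.
move=> /cliqueP hK /cliqueP hL hKL; apply/cliqueP => x y.
rewrite !(in_setU x) !(in_setU y) => /orP[xK|xL] /orP[yK|yL] xy.
- exact: hK.
- exact: hKL.
- by rewrite nbhC; apply: hKL.
- exact: hL.
Qed.

Lemma clique0 (T : finType) (G : sgraph T) : clique G set0.
Proof. by apply/cliqueP => x y; rewrite inE. Qed.

Lemma clique1 (T : finType) (G : sgraph T) (x : T) : clique G [set x].
Proof. by apply/cliqueP => y z; rewrite !inE => /eqP-> /eqP->; rewrite eqxx. Qed.

(** * Large cliques and clique partitions in locally dense graphs *)

Lemma sum_card_nbh (T : finType) (G : sgraph T) (W : {set T}) :
  2 * #|edges_in G W| <= \sum_(v in W) #|nbh G v :&: W|.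
Proof.
have -> : 2 * #|edges_in G W| = \sum_(e in edges_in G W) \sum_(v in W) (v \in e).
  rewrite mulnC -sum_nat_const; apply: eq_bigr => e.
  rewrite inE => /andP[/(subsetP (valP G)) e2 eW].
  move: e2; rewrite inE => /eqP <-.
  rewrite -sum1_card big_mkcond [RHS]big_mkcond; apply: eq_bigr => v _ /=.
  by case: (boolP (v \in e)) => [/(subsetP eW)->|_] //; case: ifP.
rewrite exchange_big; apply: leq_sum => v vW /=.
rewrite -big_mkcondr sum1_card.
apply: leq_trans (leq_imset_card (fun u => [set v; u]) _).
apply: subset_leq_card; apply/fintype.subsetP => e.
rewrite unfold_in /= inE => /andP[/andP[eG eW] ve].
have := subsetP (valP G) _ eG; rewrite inE => /cards2P[a [b [ab eE]]].
have [u eu] : exists u, e = [set v; u].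
  move: ve; rewrite eE !inE => /orP[] /eqP->; [by exists b|by exists a; rewrite setUC].
apply/imsetP; exists u => //; rewrite !inE -eu eG.
by apply: (subsetP eW); rewrite eu !inE eqxx orbT.
Qed.

(** Averaging: were every [r * #|nbh G v :&: W|] below [#|W|], hence at most [#|W|.-1], the degree
    sum would contradict the hypothesis. *)
Lemma dense_nbh (T : finType) (G : sgraph T) (W : {set T}) (r : nat) :
  'C(#|W|, 2) < r * #|edges_in G W| ->
  exists2 v, v \in W & #|W| <= r * #|nbh G v :&: W|.
Proof.
move=> h; apply/exists_inP; apply: contraLR h; rewrite -leqNgt => /exists_inPn h.
rewrite -(@leq_pmul2l 2) // mulnCA.
apply: leq_trans (leq_mul (leqnn r) (sum_card_nbh G W)) _.
rewrite big_distrr /= mulnC bin2 muln2.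
apply: (@leq_trans (\sum_(v in W) #|W|.-1)).
  apply: leq_sum => v vW; have := h v vW; rewrite -ltnNge.
  by case: #|W|.
rewrite sum_nat_const -[leqLHS]odd_double_half; move: #|W| => [|m] //=.
by rewrite oddM /= andNb.
Qed.

Definition locally_dense (T : finType) (G : sgraph T) (r t : nat) :=
  forall W : {set T}, t <= #|W| -> 'C(#|W|, 2) < r * #|edges_in G W|.

(** Each descent to a neighbourhood costs a factor [r], so the size stays at least [t] through all
    [j] choices of a vertex. *)
Lemma dense_clique (T : finType) (G : sgraph T) (r t : nat) :
  0 < r -> locally_dense G r t ->
  forall (j : nat) (W : {set T}), r ^ j * t <= #|W| ->
  exists K : {set T}, [/\ K \subset W, clique G K & #|K| = j].
Proof.
move=> r0 hG; elim=> [|j IH] W hW.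
  by exists set0; rewrite sub0set clique0 cards0.
have tW : t <= #|W| by apply: leq_trans hW; rewrite leq_pmull // expn_gt0 r0.
have [v vW hv] := dense_nbh (hG W tW).
have [|K [KW cK sK]] := IH (nbh G v :&: W).
  by rewrite -(leq_pmul2l r0) mulnA -expnS; apply: leq_trans hv.
have /subsetP KN := subset_trans KW (subsetIl _ _).
exists (v |: K); split.
- by rewrite subUset sub1set vW; apply: subset_trans KW (subsetIr _ _).
- by apply: clique_setU (clique1 _ _) cK _ => x y /set1P -> /KN.
by rewrite cardsU1 sK; case: (boolP (v \in K)) => // /KN; rewrite nbhxx.
Qed.

(** Each clique removed greedily uses up [k] vertices, which pay for it in [k * #|P|]; the fewer
    than [N] leftover vertices become singletons at cost [k] each. *)
Lemma clique_partition (T : finType) (G : sgraph T) (k N : nat) :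
  0 < k ->
  (forall W : {set T}, N <= #|W| ->
     exists K : {set T}, [/\ K \subset W, clique G K & #|K| = k]) ->
  forall W : {set T}, exists P : {set {set T}},
    [/\ partition P W, {in P, forall K, clique G K /\ #|K| <= k}
      & k * #|P| <= #|W| + k * N].
Proof.
move=> k0 hN W; have [m] := ubnP #|W|; elim: m W => // m IH W; rewrite ltnS => hm.
case: (leqP N #|W|) => [/hN [K [KW cK sK]]|WN].
  have WE : #|W| = k + #|W :\: K| by rewrite cardsDS // sK subnKC // -sK subset_leq_card.
  have [|P [pP cP sP]] := IH (W :\: K).
    by apply: leq_trans hm; rewrite WE -[ltnLHS]add0n ltn_add2r.
  have K0 : K != set0 by rewrite -card_gt0 sK.
  have KP : K \notin P.
    apply/negP => KP; have := partitionS pP KP => /subsetP KD.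
    by have /set0Pn[x xK] := K0; have := KD x xK; rewrite inE xK.
  exists (K |: P); split.
  - rewrite -(setID W K) (setIidPr KW); apply: partitionU1 => //.
    by rewrite disjoint_sym -setI_eq0 setIDAC setDIl setDv setI0 .
  - by move=> L /setU1P[->|/cP//]; rewrite sK.
  - by rewrite cardsU1 KP mulnDr muln1 WE -addnA leq_add2l.
exists [set [set x] | x in W]; split.
- apply/and3P; split.
  + rewrite cover_imset; apply/eqP/setP => x; apply/bigcupP/idP => [[y yW /set1P->//]|xW].
    by exists x => //; rewrite set11.
  + apply/trivIsetP => _ _ /imsetP[x _ ->] /imsetP[y _ ->] xy.
    by rewrite disjoints1 inE; apply: contra xy => /eqP->.
  + by apply/imsetP => -[x _ /esym/eqP]; rewrite -cards_eq0 cards1.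
- by move=> _ /imsetP[x _ ->]; rewrite cards1 clique1.
- by rewrite card_imset; [rewrite (leq_trans (leq_mul (leqnn k) (ltnW WN)))// leq_addl|exact: set1_inj].
Qed.

(** * Thickness bounds for a fixed graph *)

Lemma card_bigcup_leq (I T : finType) (A : {set I}) (F : I -> {set T}) :
  #|\bigcup_(i in A) F i| <= \sum_(i in A) #|F i|.
Proof.
apply: (big_ind2 (fun (U : {set T}) m => #|U| <= m)) => [|U m V n hU hV|//].
  by rewrite cards0.
by apply: leq_trans (leq_card_setU U V).1 _; exact: leq_add.
Qed.

(* Take a partition B of the vertices into cliques and, for every b in B and
   every S \subset b, a partition into cliques of the vertices outside b whose
   neighbourhood in b is exactly S; each of these cliques can be joined to S.
   A vertex of b lies in all the cliques built from b, but it lies in a single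
   clique built from any other block. *)
Lemma theta0_upper (T : finType) (G : sgraph T) (k N : nat) :
  0 < k ->
  (forall W : {set T}, N <= #|W| ->
     exists K : {set T}, [/\ K \subset W, clique G K & #|K| = k]) ->
  k * theta0 G <= k + 2 * #|T| + (2 ^ k).+1 * (k * N).
Proof.
move=> k0 hN.
have [f fP] := fin_all_exists (clique_partition k0 hN).
pose B := f setT.
pose U (b S : {set T}) := [set u | (u \notin b) && (nbh G u :&: b == S)].
have [pB cB sB] := fP setT; rewrite cardsT -/B in pB cB sB.
have vB v : v \in cover B by rewrite (cover_partition pB) inE.
pose Q b S := [set S :|: K | K in f (U b S)].
pose C := B :|: \bigcup_(b in B) \bigcup_(S in powerset b) Q b S.
have C_cover : clique_cover G C.
  apply/andP; split.
    apply/forall_inP => K /setUP[/cB[]//|/bigcupP[b bB] /bigcupP[S]].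
    rewrite powersetE => Sb /imsetP[L LU ->].
    have [pU cU _] := fP (U b S).
    apply: clique_setU; first exact: clique_sub Sb (cB _ bB).1.
      exact: (cU _ LU).1.
    move=> x y xS yL; have := subsetP (partitionS pU LU) _ yL.
    by rewrite inE nbhC => /andP[_ /eqP SE]; move: xS; rewrite -SE => /setIP[].
  apply/forall_inP => e eG; apply/exists_inP.
  have := subsetP (valP G) _ eG; rewrite inE => /cards2P[x [y [xy eE]]].
  have bB : pblock B x \in B by exact: pblock_mem.
  have xb : x \in pblock B x by rewrite mem_pblock.
  case: (boolP (y \in pblock B x)) => yb.
    exists (pblock B x); first by rewrite inE bB.
    by rewrite eE subUset !sub1set xb.
  (* The trace [S] of [y] contains [x], so joining [S] to the clique of [y] within its group covers
     the edge. *)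
  pose S := nbh G y :&: pblock B x.
  have [pU cU _] := fP (U (pblock B x) S).
  have yU : y \in cover (f (U (pblock B x) S)).
    by rewrite (cover_partition pU) inE yb eqxx.
  exists (S :|: pblock (f (U (pblock B x) S)) y).
    apply/setUP; right; apply/bigcupP; exists (pblock B x) => //.
    apply/bigcupP; exists S; first by rewrite powersetE subsetIr.
    by apply: imset_f; exact: pblock_mem.
  rewrite eE subUset !sub1set !(in_setU _ S) mem_pblock yU orbT andbT.
  by rewrite /S !inE setUC -eE eG xb.
apply: leq_trans (leq_mul (leqnn k) (theta0_min C_cover)) _.
rewrite /thickness mulnC -leq_divRL //; apply/bigmax_leqP => v _.
rewrite leq_divRL // mulnC.
pose b0 := pblock B v.
have b0B : b0 \in B by exact: pblock_mem.
(* For a block [b] without [v], [g b] is the only clique built from [b] that can contain [v]. *)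
pose g b := let S := nbh G v :&: b in S :|: pblock (f (U b S)) v.
have sub : [set K in C | v \in K] \subset
    b0 |: ([set g b | b in B] :|: \bigcup_(S in powerset b0) Q b0 S).
  apply/fintype.subsetP => K; rewrite inE => /andP[/setUP[KB|/bigcupP[b bB] KQ] vK].
    apply/setUP; left; apply/set1P; apply: esym.
    exact: def_pblock (partition_trivIset pB) KB vK.
  apply/setUP; right; apply/setUP.
  case: (boolP (v \in b)) => vb.
    by right; rewrite /b0 (def_pblock (partition_trivIset pB) bB vb).
  left; move: KQ => /bigcupP[S]; rewrite powersetE => /subsetP Sb /imsetP[L LU KE].
  have [pU _ _] := fP (U b S).
  have vL : v \in L.
    by move: vK; rewrite KE => /setUP[/Sb|//]; rewrite (negbTE vb).
  have := subsetP (partitionS pU LU) _ vL; rewrite inE => /andP[_ /eqP SE].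
  apply/imsetP; exists b => //.
  by rewrite /g SE (def_pblock (partition_trivIset pU) LU vL).
apply: leq_trans (leq_mul (leqnn k) (subset_leq_card sub)) _.
rewrite cardsU1.
apply: (@leq_trans (k * (1 + (#|B| + \sum_(S in powerset b0) #|f (U b0 S)|)))).
  rewrite leq_mul2l; apply/orP; right; apply: leq_add; first exact: leq_b1.
  apply: leq_trans (leq_card_setU _ _).1 _; apply: leq_add; first exact: leq_imset_card.
  apply: leq_trans (card_bigcup_leq _ _) _; apply: leq_sum => S _.
  exact: leq_imset_card.
rewrite !mulnDr muln1 -addnA leq_add2l.
have -> : 2 * #|T| + (2 ^ k).+1 * (k * N) = #|T| + k * N + (#|T| + 2 ^ k * (k * N)).
  by rewrite mul2n mulSn -addnn addnACA.
apply: leq_add => //; rewrite big_distrr /=.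
apply: (@leq_trans (\sum_(S in powerset b0) (#|U b0 S| + k * N))).
  by apply: leq_sum => S _; have [] := fP (U b0 S).
rewrite big_split /= sum_nat_const card_powerset; apply: leq_add; last first.
  by rewrite leq_mul2r leq_exp2l // (cB _ b0B).2 orbT.
(* Each vertex has a single trace on [b0], so the groups [U b0 S] are disjoint and their sizes add
   up to at most [#|T|]. *)
rewrite -cardsT -sum1_card (partition_big (fun u => nbh G u :&: b0) (mem (powerset b0))) /=.
  apply: leq_sum => S _; rewrite -sum1_card.
  rewrite [leqLHS]big_mkcond [leqRHS]big_mkcond /=; apply: leq_sum => u _.
  by rewrite !inE /=; case: (u \notin b0); case: eqP.
by move=> u _; rewrite powersetE subsetIr.
Qed.

(* Some vertex has degree at least #|T| / r, and a clique containing it covers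
   at most L of its edges. *)
Lemma theta0_lower (T : finType) (G : sgraph T) (r L : nat) :
  'C(#|T|, 2) < r * #|edges G| ->
  (forall K : {set T}, clique G K -> #|K| <= L) ->
  #|T| <= r * (L * theta0 G).
Proof.
move=> hE hK.
have [|v _] := @dense_nbh _ G setT r.
  rewrite cardsT (_ : edges_in G setT = edges G) //.
  by apply/setP => e; rewrite inE subsetT andbT.
rewrite cardsT setIT => /leq_trans; apply; rewrite leq_mul2l; apply/orP; right.
have [C /andP[/forall_inP cC /forall_inP hC] <-] := theta0_attained G.
apply: (@leq_trans #|\bigcup_(K in [set K in C | v \in K]) K|).
  apply: subset_leq_card; apply/fintype.subsetP => u; rewrite inE => /hC/exists_inP[K KC].
  rewrite subUset !sub1set => /andP[vK uK].
  by apply/bigcupP; exists K => //; rewrite inE KC.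
apply: leq_trans (card_bigcup_leq _ _) _.
apply: (@leq_trans (\sum_(K in [set K in C | v \in K]) L)).
  by apply: leq_sum => K; rewrite inE => /andP[/cC/hK].
rewrite sum_nat_const mulnC leq_mul2l; apply/orP; right.
exact: (leq_bigmax v).
Qed.

(** * Counting estimates and choice of parameters *)

Lemma bin_leq_exp (n m : nat) : 'C(n, m) <= n ^ m.
Proof.
apply: (@leq_trans (n ^_ m)).
  by rewrite -bin_ffact leq_pmulr // fact_gt0.
elim: m => // m IH; rewrite ffactnSr expnSr; apply: leq_mul => //; exact: leq_subr.
Qed.

(** Cliques are closed under subsets, so the first moment need only treat one size. *)
Lemma clique_leq (T : finType) (G : sgraph T) (L : nat) :
  (forall K : {set T}, #|K| = L.+1 -> ~~ clique G K) ->
  forall K : {set T}, clique G K -> #|K| <= L.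
Proof.
move=> h K cK; rewrite leqNgt; apply/negP => LK.
have : 0 < #|[set B : {set T} | B \subset K & #|B| == L.+1]|.
  by rewrite cards_draws bin_gt0.
case/card_gt0P => B; rewrite inE => /andP[BK /eqP /h].
by rewrite (clique_sub BK cK).
Qed.

(* In the application (2 * r) ^ (4 * k) is about n, so that s is about the
   square root of n. Cliques of size k exist in all sets of size r ^ k * t, and
   the error terms 2 ^ k * k * (r ^ k * t) of theta0_upper are O(s * t) = O(n). *)
Lemma theta0_dense (T : finType) (G : sgraph T) (r M k : nat) :
  let s := ((2 * r) ^ k) ^ 2 in let t := 4 * M * (2 * r) ^ 4 * s in
  0 < r -> 0 < k -> s ^ 2 <= #|T| -> locally_dense G r t ->
  k * theta0 G <= (8 * M * (2 * r) ^ 4 + 3) * #|T|.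
Proof.
move=> s t r0 k0 sT hG.
have k2 : k <= (2 * r) ^ k.
  apply: leq_trans (ltnW (ltn_expl k (ltnSn 1))) _.
  by rewrite leq_exp2r // leq_pmulr.
have s0 : (2 * r) ^ k <= s by rewrite /s -mulnn leq_pmulr // expn_gt0 muln_gt0 r0.
have sT' : s <= #|T|.
  by apply: leq_trans sT; rewrite -mulnn leq_pmulr // expn_gt0 expn_gt0 muln_gt0 r0.
apply: leq_trans (theta0_upper k0 (dense_clique r0 hG (j := k))) _.
have h : (2 ^ k).+1 * (k * (r ^ k * t)) <= 8 * M * (2 * r) ^ 4 * #|T|.
  apply: (@leq_trans (2 * (s * t))).
    (* The last factor absorbs [k], and the leading 2 absorbs the successor in [(2 ^ k).+1]. *)
    have -> : s = 2 ^ k * r ^ k * (2 * r) ^ k by rewrite -expnMn /s -mulnn.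
    have : 0 < 2 ^ k by rewrite expn_gt0.
    move: (2 ^ k) (r ^ k) ((2 * r) ^ k) k2 => x y z kz x0.
    rewrite (_ : 2 * _ = 2 * x * (z * (y * t))); last by lia.
    by rewrite leq_mul ?leq_mul //; lia.
  apply: leq_trans (leq_mul (leqnn _) sT); rewrite /t -mulnn.
  by move: (s) ((2 * r) ^ 4) => x y; lia.
have kT : k <= #|T| by apply: leq_trans k2 (leq_trans s0 sT').
by lia.
Qed.

(** Supplies the exponent of the union bound: sets of order sqrt n already have enough pairs to beat
    the [2 ^ n] choices of a set. *)
Lemma bin2_large (M D s n w : nat) :
  0 < M -> n <= D * s ^ 2 -> 4 * M * D * s <= w -> M * n <= 'C(w, 2).
Proof.
move=> M0 nD tw; apply: leq_trans (leq_bin2l 2 tw).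
apply: leq_trans (leq_mul (leqnn M) nD) _.
have [Ds|Ds] := posnP (D * s); first by rewrite -mulnn [D * _]mulnA Ds muln0.
have -> : 4 * M * D * s = (2 * M * D * s).*2 by lia.
rewrite bin2 -doubleMl doubleK -mulnn.
apply: (@leq_trans ((2 * M * D * s) * (2 * M * D * s))); last by rewrite leq_mul //; nia.
rewrite (_ : _ * _ * (2 * _ * _ * _) = (M * (D * (s * s))) * (4 * M * D)); last by lia.
by rewrite leq_pmulr // !muln_gt0 M0; move: Ds; rewrite muln_gt0 => /andP[].
Qed.

(** With [D = (2 * r) ^ 4], the [s] of [theta0_dense] satisfies [s ^ 2 = D ^ k], which suggests
    [k = trunc_log D n]. *)
Lemma expn_scale (r k : nat) : (((2 * r) ^ k) ^ 2) ^ 2 = ((2 * r) ^ 4) ^ k.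
Proof. by rewrite -!expnM (mulnC k). Qed.

(** * Probability estimates in the random graph *)

Import Order.TTheory GRing.Theory Num.Theory.
Local Open Scope ring_scope.

(** Expanding the product chooses [f e] or [g e] for each pair, that is, a graph. Independence of
    the edges enters in this form. *)
Lemma sum_sgraph_prod (R : comPzRingType) (T : finType) (f g : {set T} -> R) :
  \sum_(G : sgraph T) \prod_(e in vpairs T) (if e \in edges G then f e else g e)
  = \prod_(e in vpairs T) (f e + g e).
Proof.
pose V := vpairs T.
pose m (E : {set {set T}}) : R := \prod_(e in V) (if e \in E then f e else g e).
have -> : \sum_(G : sgraph T) m (val G) = \sum_(E : {set {set T}} | E \subset V) m E.
  by apply: esym; exact: (@big_sub _ _ _ _ (fun E : {set {set T}} => E \subset V) m).
(* Outside [V], the values 0 and 1 kill every set that is not an edge set and leave the other terms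
   unchanged. *)
pose F e : R := if e \in V then f e else 0.
pose H e : R := if e \in V then g e else 1.
transitivity (\prod_e (F e + H e)); last first.
  by rewrite [RHS]big_mkcond; apply: eq_bigr => e _; rewrite /F /H; case: ifP; rewrite ?add0r.
rewrite bigA_distr [RHS](bigID (fun E : {set {set T}} => E \subset V)) /=.
rewrite [X in _ + X]big1 ?addr0 => [|E /subsetPn[e eE eV]]; last first.
  by rewrite (bigD1 e) //= eE /F (negbTE eV) mul0r.
apply: eq_bigr => E EV; rewrite /m big_mkcond; apply: eq_bigr => e _.
rewrite /F /H; case: (boolP (e \in V)) => eV //.
by rewrite (contraNF (subsetP EV e) eV).
Qed.

Lemma gnp_mass_ge0 (R : realType) (n : nat) (p : R) (G : sgraph 'I_n) :
  0 <= p <= 1 -> 0 <= gnp_mass p G.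
Proof.
by move=> /andP[p0 p1]; apply: prodr_ge0 => e _; case: ifP; rewrite ?subr_ge0.
Qed.

Lemma gnp_prob_union (R : realType) (n : nat) (p : R) (I : finType) (P : pred I)
    (A : I -> pred (sgraph 'I_n)) :
  0 <= p <= 1 ->
  gnp_prob p (fun G => [exists i, P i && A i G]) <= \sum_(i | P i) gnp_prob p (A i).
Proof.
move=> p01; rewrite /gnp_prob (exchange_big_dep predT) //= [leLHS]big_mkcond /=.
apply: ler_sum => G _; have m0 := gnp_mass_ge0 G p01.
case: ifP => [/existsP[i /andP[Pi Ai]]|_]; last exact: sumr_ge0.
by rewrite (bigD1 i) ?Pi //= lerDl sumr_ge0.
Qed.

Lemma card_pairs_in (T : finType) (W : {set T}) :
  #|[set e in vpairs T | e \subset W]| = 'C(#|W|, 2).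
Proof.
rewrite -cards_draws; apply: eq_card => e; rewrite !inE; exact: andbC.
Qed.

Lemma prod_pairs_in (R : comPzRingType) (T : finType) (W : {set T}) (c : R) :
  \prod_(e in vpairs T) (if e \subset W then c else 1) = c ^+ 'C(#|W|, 2).
Proof.
rewrite -card_pairs_in -big_mkcondr -prodr_const.
by apply: eq_bigl => e; rewrite inE.
Qed.

Lemma gnp_prob_clique (R : realType) (n : nat) (p : R) (K : {set 'I_n}) :
  gnp_prob p (fun G => clique G K) = p ^+ 'C(#|K|, 2).
Proof.
rewrite -prod_pairs_in /gnp_prob big_mkcond /=.
(* The indicator of the event is absorbed into the weights: a missing pair inside [K] gets weight
   0. *)
transitivity (\sum_(G : sgraph 'I_n) \prod_(e in vpairs 'I_n)
   (if e \in edges G then p else if e \subset K then 0 else 1 - p)); last first.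
  rewrite sum_sgraph_prod; apply: eq_bigr => e _; case: ifP => _; first by rewrite addr0.
  by rewrite subrKC.
apply: eq_bigr => G _; case: ifP => [cK|/negbT].
  apply: eq_bigr => e ev; case: ifP => // eG; case: ifP => // eK.
  move: ev; rewrite inE => /cards2P[x [y [xy eE]]].
  move: eK; rewrite eE subUset !sub1set => /andP[xK yK].
  have := forall_inP (forall_inP cK _ xK) _ yK.
  by rewrite xy -eE eG.
rewrite negb_forall_in => /exists_inP[x xK]; rewrite negb_forall_in => /exists_inP[y yK].
rewrite negb_imply => /andP[xy xyG].
rewrite (bigD1 [set x; y]) /= ?inE ?cards2 ?xy //.
by rewrite (negbTE xyG) subUset !sub1set xK yK mul0r.
Qed.

(* Chernoff bound: Markov's inequality for x ^+ (r * #|edges_in G W|). *)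
Lemma gnp_prob_sparse (R : realType) (n : nat) (p x : R) (r : nat) (W : {set 'I_n}) :
  0 <= p <= 1 -> 0 < x <= 1 ->
  gnp_prob p (fun G => r * #|edges_in G W| <= 'C(#|W|, 2))%N
  <= ((p * x ^+ r + (1 - p)) / x) ^+ 'C(#|W|, 2).
Proof.
move=> p01 /andP[x0 x1]; rewrite expr_div_n.
have -> : (p * x ^+ r + (1 - p)) ^+ 'C(#|W|, 2) =
    \sum_(G : sgraph 'I_n) gnp_mass p G * x ^+ (r * #|edges_in G W|).
  rewrite -prod_pairs_in.
  transitivity (\prod_(e in vpairs 'I_n) (p * (if e \subset W then x ^+ r else 1) + (1 - p))).
    by apply: eq_bigr => e _; case: ifP => _ //; rewrite mulr1 subrKC.
  rewrite -sum_sgraph_prod; apply: eq_bigr => G _.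
  have -> : x ^+ (r * #|edges_in G W|) =
     \prod_(e in vpairs 'I_n) (if e \in edges G then if e \subset W then x ^+ r else 1 else 1).
    rewrite exprM -prodr_const -!big_mkcondr /=.
    apply: eq_bigl => e.
    rewrite !inE; case: (boolP (e \in edges G)) => [eG|_]; last by rewrite andbF.
    by have := subsetP (valP G) _ eG; rewrite inE => ->.
  rewrite -big_split; apply: eq_bigr => e _ /=.
  by case: ifP => _ //; rewrite mulr1.
rewrite mulr_suml /gnp_prob big_mkcond; apply: ler_sum => G _.
have m0 := gnp_mass_ge0 G p01.
case: ifP => [h|_]; last by rewrite divr_ge0 // ?mulr_ge0 // exprn_ge0 // ltW.
rewrite -mulrA -[leLHS]mulr1 ler_wpM2l // ler_pdivlMr ?exprn_gt0 // mul1r.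
by rewrite ler_wiXn2l // ltW.
Qed.

(* Failure probabilities and passage to the scale n / log n *)
From mathcomp Require Import all_classical all_reals all_analysis.
Import numFieldNormedType.Exports.

Lemma exists_expr_lt (R : realType) (x e : R) : 0 <= x < 1 -> 0 < e ->
  exists m : nat, x ^+ m < e.
Proof.
move=> /andP[x0 x1] e0.
have /cvgrPdist_lt/(_ e e0) : ((GRing.exp x : nat -> R) @ \oo --> (0 : R))%classic.
  by apply: cvg_expr; rewrite ger0_norm.
case=> m _ /(_ m (leqnn m)); rewrite /= sub0r normrN ger0_norm ?exprn_ge0 //.
by exists m.
Qed.

(** Each large [W] is sparse with probability at most [q ^+ (m * n) <= 4 ^- n], and there are
    [2 ^ n] sets. *)
Lemma gnp_prob_not_locally_dense (R : realType) (n r t m : nat) (p q x : R) :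
  0 <= p <= 1 -> 0 < x <= 1 -> (p * x ^+ r + (1 - p)) / x <= q -> q <= 1 ->
  q ^+ m <= 4^-1 ->
  (forall w : nat, t <= w -> m * n <= 'C(w, 2))%N ->
  gnp_prob p (fun G : sgraph 'I_n =>
    [exists W : {set 'I_n}, (t <= #|W|) && (r * #|edges_in G W| <= 'C(#|W|, 2))]%N)
  <= 2 ^- n.
Proof.
move=> p01 x01 hq q1 qm ht.
have /andP[x0 _] := x01; have /andP[p0 p1] := p01.
have q0 : 0 <= (p * x ^+ r + (1 - p)) / x.
  have xr : 0 <= p * x ^+ r by rewrite mulr_ge0 // exprn_ge0 // ltW.
  by apply: divr_ge0; [rewrite (addr_ge0 xr) // subr_ge0|exact: ltW].
apply: le_trans (gnp_prob_union _ _ p01) _.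
apply: (@le_trans _ _ (\sum_(W : {set 'I_n}) 4 ^- n)).
  rewrite [leLHS]big_mkcond /=; apply: ler_sum => W _.
  case: ifP => [tW|_]; last by rewrite invr_ge0 exprn_ge0.
  apply: le_trans (gnp_prob_sparse _ _ p01 x01) _.
  have h0 : 0 <= q by apply: le_trans hq.
  apply: (@le_trans _ _ (q ^+ 'C(#|W|, 2))); first by rewrite lerXn2r.
  apply: (@le_trans _ _ (q ^+ (m * n))); first by rewrite ler_wiXn2l // ht.
  by rewrite exprM -exprVn lerXn2r // nnegrE ?exprn_ge0.
rewrite sumr_const -cardsT -powersetT card_powerset cardsT card_ord.
rewrite -[_ *+ (2 ^ n)]mulr_natl natrX.
by rewrite (_ : 4 = 2 * 2 :> R) ?exprMn ?invfM ?mulVKf // ?expf_neq0 // -natrM.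
Qed.

(** Since [L] is odd, [L] vertices have exactly [m * L] pairs, so the first moment is at most
    [(n%:R * p ^+ m) ^+ L], whose base is at most 1. *)
Lemma gnp_prob_large_clique (R : realType) (n L m : nat) (p : R) :
  0 <= p <= 1 -> n%:R * p ^+ m <= 1 -> L = (2 * m).+1 ->
  gnp_prob p (fun G : sgraph 'I_n =>
    [exists K : {set 'I_n}, (#|K| == L) && clique G K]) <= n%:R * p ^+ m.
Proof.
move=> p01 hm LE; have /andP[p0 p1] := p01.
apply: le_trans (gnp_prob_union _ _ p01) _.
apply: (@le_trans _ _ (\sum_(K : {set 'I_n} | #|K| == L) p ^+ (m * L))).
  apply: ler_sum => K /eqP KL; rewrite gnp_prob_clique KL LE bin2 /=.
  by rewrite mulnCA mul2n doubleK mulnC.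
rewrite sumr_const.
have -> : #|[pred K : {set 'I_n} | #|K| == L]| = 'C(n, L).
  rewrite -[in RHS](card_ord n) -cardsT -cards_draws; apply: eq_card => K.
  by rewrite !inE finset.subsetT.
rewrite -[_ *+ _]mulr_natl exprM.
apply: (@le_trans _ _ ((n%:R * p ^+ m) ^+ L)).
  by rewrite exprMn ler_wpM2r ?exprn_ge0 // -natrX ler_nat bin_leq_exp.
by rewrite LE exprS ler_piMr ?exprn_ile1 ?mulr_ge0 ?exprn_ge0.
Qed.

Lemma gnp_prob_almost (R : realType) (n : nat) (p : R) (A B C : pred (sgraph 'I_n)) :
  0 <= p <= 1 -> (forall G, [|| A G, B G | C G]) ->
  0 <= 1 - gnp_prob p A <= gnp_prob p B + gnp_prob p C.
Proof.
move=> p01 ABC; rewrite subr_ge0 lerBlDl -(gnp_prob_total n p) /gnp_prob.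
rewrite (big_mkcond A) (big_mkcond B) (big_mkcond C) -!big_split /=.
apply/andP; split; apply: ler_sum => G _; have m0 := gnp_mass_ge0 G p01.
  by case: ifP.
by have := ABC G; case: (A G); case: (B G); case: (C G) => //= _;
  rewrite ?addr0 ?add0r ?lerDl ?addr_ge0.
Qed.

(** As [k.+1 <= 2 * k], [k] is ln n / ln D up to a factor 2. The estimates give the constants [B]
    and [2 * A]; enlarging them to [2 * B] and [3 * A] makes the inequalities strict. *)
Lemma ln_log_bounds (R : realType) (n k D A B th : nat) :
  (1 < D)%N -> (0 < k)%N -> (0 < A)%N -> (0 < B)%N ->
  (D ^ k <= n < D ^ k.+1)%N -> (k * th <= A * n)%N -> (n <= B * (k * th))%N ->
  (ln (D%:R : R) / (2 * B)%:R * (n%:R / ln n%:R) < th%:R)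
  && (th%:R < (3 * A)%:R * ln (D%:R : R) * (n%:R / ln n%:R)).
Proof.
move=> D1 k0 A0 B0 /andP[Dn nD] hA hB.
have D0 : (0 < D)%N by exact: ltnW.
have n1 : (1 < n)%N.
  by apply: leq_trans Dn; apply: leq_trans D1 _; rewrite -[leqLHS]expn1 leq_pexp2l.
have n0 : 0 < n%:R :> R by rewrite ltr0n ltnW.
have lD0 : 0 < ln (D%:R : R) by rewrite ln_gt0 // ltr1n.
have ln0 : 0 < ln (n%:R : R) by rewrite ln_gt0 // ltr1n.
have pos m : (0 < m)%N -> m%:R \is @Num.pos R by move=> m0; rewrite posrE ltr0n.
have lo : k%:R * ln (D%:R : R) <= ln n%:R.
  by rewrite mulr_natl -lnXn ?ltr0n // -natrX ler_ln ?ler_nat ?pos ?expn_gt0 ?D0 // ltnW.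
have up : ln n%:R <= k.+1%:R * ln (D%:R : R).
  rewrite mulr_natl -lnXn ?ltr0n // -natrX ler_ln ?ler_nat ?pos ?expn_gt0 ?D0 //.
    exact: ltnW nD.
  exact: ltnW.
have up2 : ln n%:R <= 2 * k%:R * ln (D%:R : R).
  apply: le_trans up _; rewrite ler_pM2r // -natrM ler_nat; lia.
have hA' : k%:R * th%:R <= A%:R * n%:R :> R by rewrite -!natrM ler_nat.
have hB' : n%:R <= B%:R * (k%:R * th%:R) :> R by rewrite -!natrM ler_nat.
have A0' : 0 < A%:R :> R by rewrite ltr0n.
have B0' : 0 < B%:R :> R by rewrite ltr0n.
have th0 : 0 <= th%:R :> R by [].
apply/andP; split.
  rewrite mulrACA -invfM ltr_pdivrMr ?mulr_gt0 ?ltr0n ?muln_gt0 //.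
  have X0 : 0 < ln (D%:R : R) * n%:R by exact: mulr_gt0.
  have XY : ln (D%:R : R) * n%:R <= th%:R * (B%:R * ln n%:R).
    apply: le_trans (ler_wpM2l (ltW lD0) hB') _.
    have -> : ln (D%:R : R) * (B%:R * (k%:R * th%:R)) = th%:R * (B%:R * (k%:R * ln D%:R)) by ring.
    by rewrite ler_wpM2l // ler_wpM2l // ltW.
  by rewrite natrM; nra.
rewrite mulrA ltr_pdivlMr //.
apply: (@le_lt_trans _ _ (2 * (A%:R * ln (D%:R : R) * n%:R))).
  apply: le_trans (ler_wpM2l th0 up2) _.
  have -> : th%:R * (2 * k%:R * ln (D%:R : R)) = 2 * (ln D%:R * (k%:R * th%:R)) by ring.
  by rewrite -mulrA (mulrCA A%:R) ler_wpM2l // ler_wpM2l // ltW.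
by rewrite natrM -!mulrA ltr_pM2r ?ltr_nat // !mulr_gt0.
Qed.

Lemma theta0_typical (R : realType) (n r D M b : nat) (G : sgraph 'I_n) :
  let k := trunc_log D n in
  let t := (4 * M * D * ((2 * r) ^ k) ^ 2)%N in
  D = ((2 * r) ^ 4)%N -> (0 < r)%N -> (0 < b)%N -> (0 < M)%N -> (4 * M * D <= k)%N ->
  locally_dense G r t ->
  (forall K, clique G K -> #|K| <= 2 * (b * k.+1))%N ->
  (ln (D%:R : R) / (2 * (r * (4 * b)))%:R * (n%:R / ln n%:R) < (theta0 G)%:R)
  && ((theta0 G)%:R < (3 * (8 * M * D + 3))%:R * ln (D%:R : R) * (n%:R / ln n%:R)).
Proof.
move=> k t DE r0 b0 M0 kD hG hK.
have D1 : (1 < D)%N by rewrite DE -[ltnLHS](exp1n 4) ltn_exp2r // mul2n -addnn -addn1 leq_add.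
have k0 : (0 < k)%N by apply: leq_trans kD; rewrite muln_gt0 (ltnW D1) muln_gt0 M0.
have n0 : (0 < n)%N by move: k0; rewrite /k trunc_log_gt0; case: (n) => //; rewrite ltn0 andbF.
have nk := trunc_log_bounds D1 n0; rewrite -/k in nk.
have sE : ((((2 * r) ^ k) ^ 2) ^ 2 = D ^ k)%N by rewrite expn_scale DE.
have sn : ((((2 * r) ^ k) ^ 2) ^ 2 <= n)%N by rewrite sE; case/andP: nk.
(* This makes local density apply to the whole vertex set, as the lower bound requires. *)
have tn : (t <= n)%N.
  apply: leq_trans sn; rewrite /t -[leqRHS]mulnn leq_mul2r; apply/orP; right.
  apply: leq_trans kD _; apply: leq_trans (ltnW (ltn_expl k (ltnSn 1))) _.
  rewrite -expnM; apply: (@leq_trans (2 ^ (k * 2))%N); first by rewrite leq_exp2l //; lia.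
  by rewrite leq_exp2r ?muln_gt0 ?k0 // leq_pmulr.
apply: (ln_log_bounds R D1 k0) => //; rewrite ?muln_gt0 ?r0 //.
- by rewrite addn3.
- have := @theta0_dense _ G r M k r0 k0; rewrite card_ord -DE; exact.
have := @theta0_lower _ G r (2 * (b * k.+1)) _ hK; rewrite card_ord.
have -> : #|edges G| = #|edges_in G [set: 'I_n]|.
  by apply: eq_card => e; rewrite inE finset.subsetT andbT.
have := hG [set: 'I_n]; rewrite cardsT card_ord => hT /(_ (hT tn)) h.
(* The 4 in [4 * b] comes from [k.+1 <= 2 * k]. *)
apply: leq_trans h _; rewrite -!mulnA leq_mul2l !mulnA leq_mul2r; apply/orP; right; apply/orP; right.
by nia.
Qed.

Unset Implicit Arguments.
Local Open Scope classical_set_scope.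
Local Open Scope ring_scope.

Theorem theorem9 (R : realType) (p : R) (hp0 : 0 < p) (hp1 : p < 1) :
  exists c1 c2 : R, [/\ 0 < c1, 0 < c2 &
    (fun n : nat => gnp_prob p (fun G : sgraph 'I_n =>
        (c1 * (n%:R / ln n%:R) < (theta0 G)%:R)
        && ((theta0 G)%:R < c2 * (n%:R / ln n%:R)))) @ \oo --> (1 : R)].
Proof.
have p01 : 0 <= p <= 1 by rewrite !ltW.
(* With x = 1 - p / 2 and x ^+ r < 1 / 2, the Chernoff base
   p x ^+ r + (1 - p) is smaller than x. *)
pose x := 1 - p / 2.
have x0 : 0 < x by rewrite /x; lra.
have x1 : x < 1 by rewrite /x; lra.
have [r hr] : exists r : nat, x ^+ r < 2^-1 by apply: exists_expr_lt; rewrite ?(ltW x0) ?x1 ?invr_gt0.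
have r0 : (0 < r)%N by case: r hr => //; rewrite expr0 => ?; lra.
pose q := (p * x ^+ r + (1 - p)) / x.
have xr0 : 0 <= x ^+ r by rewrite exprn_ge0 // ltW.
have q0 : 0 <= q by rewrite /q divr_ge0 ?(ltW x0) //; nra.
have q1 : q < 1 by rewrite /q ltr_pdivrMr // mul1r /x; nra.
(* With this [M], [q ^+ (M * n)] is at most [4 ^- n], which beats the union over [2 ^ n] sets. *)
have [M hM] : exists M : nat, q ^+ M < 4^-1 by apply: exists_expr_lt; rewrite ?q0 ?q1 ?invr_gt0.
have M0 : (0 < M)%N by case: M hM => //; rewrite expr0 => ?; lra.
have [D DE] : exists D, D = ((2 * r) ^ 4)%N by exists ((2 * r) ^ 4)%N.
have D1 : (1 < D)%N by rewrite DE -[ltnLHS](exp1n 4) ltn_exp2r // mul2n -addnn -addn1 leq_add.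
have D2 : (0 < D * 2)%N by rewrite muln_gt0 ltnW.
(* As [n < D ^ k.+1], this [b] will give [n%:R * p ^+ (b * k.+1) <= 2 ^- k.+1]. *)
have [b hb] : exists b : nat, p ^+ b < (D * 2)%:R^-1.
  by apply: exists_expr_lt; rewrite ?ltW ?invr_gt0 ?ltr0n.
have b0 : (0 < b)%N.
  case: b hb => //; rewrite expr0 => h.
  suff : (D * 2)%:R^-1 <= 1 :> R by move=> ?; lra.
  by rewrite invf_le1 ?ler1n ?ltr0n.
have lD0 : 0 < ln (D%:R : R) by rewrite ln_gt0 // ltr1n.
exists (ln (D%:R : R) / (2 * (r * (4 * b)))%:R), ((3 * (8 * M * D + 3))%:R * ln (D%:R : R)).
split; first by rewrite divr_gt0 // ltr0n !muln_gt0 r0 b0.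
  by rewrite mulr_gt0 // ltr0n addn3.
apply/cvgrPdist_lt => e e0.
have [K hK] : exists K : nat, (2^-1 : R) ^+ K < e / 2.
  by apply: exists_expr_lt; [apply/andP; split; lra|lra].
(* The threshold forces [K + 4 * M * D <= k]: [K] makes each failure probability less than [e / 2],
   and [4 * M * D] meets the condition of [theta0_typical]. *)
exists (D ^ (K + 4 * M * D))%N => // n /= Dn.
have Kn := trunc_log_max D1 Dn; set k := trunc_log D n in Kn.
have n0 : (0 < n)%N by apply: leq_trans Dn; rewrite expn_gt0 ltnW.
have /andP[Dkn nDk] := trunc_log_bounds D1 n0; rewrite -/k in Dkn nDk.
pose t := (4 * M * D * ((2 * r) ^ k) ^ 2)%N.
set E := fun _ => _.
pose B1 (G : sgraph 'I_n) :=
  [exists W : {set 'I_n}, (t <= #|W|) && (r * #|edges_in G W| <= 'C(#|W|, 2))]%N.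
pose B2 (G : sgraph 'I_n) :=
  [exists K : {set 'I_n}, (#|K| == (2 * (b * k.+1)).+1) && clique G K].
have /andP[E0 E1] : 0 <= 1 - gnp_prob p E <= gnp_prob p B1 + gnp_prob p B2.
  apply: gnp_prob_almost => // G; rewrite orbC -implyNb negb_or; apply/implyP => /andP[h1 h2].
  apply: theta0_typical => //; first by apply: leq_trans Kn; rewrite leq_addl.
    move=> W tW; rewrite ltnNge; apply: contra h1 => h.
    by apply/existsP; exists W; rewrite tW.
  apply: clique_leq => C CL; apply: contra h2 => h.
  by apply/existsP; exists C; rewrite CL eqxx.
rewrite ger0_norm //; apply: le_lt_trans E1 _.
have hk (m : nat) : (K <= m)%N -> 2 ^- m < e / 2.
  move=> Km; apply: le_lt_trans hK; rewrite -exprVn ler_wiXn2l //; lra.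
have KK : (K <= k)%N by apply: leq_trans Kn; rewrite leq_addr.
rewrite [e]splitr; apply: ltrD.
  apply: le_lt_trans _ (hk n _); last first.
    exact: leq_trans KK (leq_trans (ltnW (ltn_expl k D1)) Dkn).
  apply: (gnp_prob_not_locally_dense p01 (x := x) (q := q) (m := M)) => //.
  - by rewrite x0 ltW.
  - exact: ltW.
  - exact: ltW.
  (* Here [s = ((2 * r) ^ k) ^ 2], and [D * s ^ 2 = D ^ k.+1] exceeds [n]. *)
  by move=> w; apply: bin2_large => //; rewrite expn_scale -DE -expnS ltnW.
have Dp : n%:R * p ^+ (b * k.+1) <= 2 ^- k.+1.
  apply: (@le_trans _ _ (D%:R ^+ k.+1 * (D * 2)%:R^-1 ^+ k.+1)).
    apply: ler_pM => //; first by rewrite exprn_ge0 // ltW.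
      by rewrite -natrX ler_nat ltnW.
    by rewrite exprM lerXn2r ?nnegrE ?exprn_ge0 ?invr_ge0 // ltW.
  by rewrite -exprMn natrM invfM mulrA divff ?mul1r ?exprVn // pnatr_eq0 -lt0n ltnW.
have Dp1 : n%:R * p ^+ (b * k.+1) <= 1.
  by rewrite (le_trans Dp) // invf_le1 ?exprn_gt0 // exprn_ege1 // ler1n.
apply: le_lt_trans _ (hk k.+1 (leqW KK)); apply: le_trans _ Dp.
exact: gnp_prob_large_clique.
Qed.
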